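(* Let $g\in C_B[0,\infty)$. Then for every $n\in\mathbb{N}$ and every $x\in[0,\infty)$, $$|\mathcal{RL}_{n}^{[\alpha]}(g;x)-g(x)|\leq 5\left(\omega\left(g,\sqrt{\Phi_{n,2}^{\alpha}(x)}\right)+\frac{9}{10}\,\omega_2\left(g,\sqrt{\Phi_{n,2}^{\alpha}(x)}\right)\right).$$
   Context: Standing data: $(\beta_n)_{n\in\mathbb N}$ is a strictly increasing sequence of real numbers with $\beta_1=1$ and $\beta_n\to\infty$; $\phi,\psi$ are fixed reals with $0\le\phi\le\psi$; $\alpha=\alpha_n\ge 0$ is a sequence of nonnegative reals (the index $n$ is suppressed). For $i\ge1$ put $x^{(i,-\alpha)}=\prod_{j=1}^{i}(x+(j-1)\alpha)$, and $x^{(0,-\alpha)}=1$. For $x\ge0$ and bounded locally integrable $g$ on $[0,\infty)$ (or, more generally, locally integrable $g$ for which the series converges absolutely) define $$\mathcal{RL}_{n}^{[\alpha]}(g;x)=\beta_n\sum_{i=0}^{\infty}(1+\beta_n\alpha)^{-x/\alpha}\left(\alpha+\frac{1}{\beta_n}\right)^{-i}\frac{x^{(i,-\alpha)}}{i!}\int_{i/\beta_n}^{(i+1)/\beta_n}g\left(\frac{\beta_n t+\phi}{\beta_n+\psi}\right)dt,$$ where for $\alpha=0$ the factor $(1+\beta_n\alpha)^{-x/\alpha}$ is read as its limit $e^{-\beta_n x}$. Put $\Phi_{n,2}^{\alpha}(x)=\mathcal{RL}_{n}^{[\alpha]}((t-x)^2;x)$, the operator acting on the function of the variable $t$. $C_B[0,\infty)$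 is the space of bounded continuous real functions on $[0,\infty)$. For $\delta>0$, $$\omega(g,\delta)=\sup_{x,u,v\ge0,\ |u-v|\le\delta}|g(x+u)-g(x+v)|,\qquad \omega_2(g,\delta)=\sup_{x,u,v\ge0,\ |u-v|\le\delta}|g(x+2u)-2g(x+u+v)+g(x+2v)|.$$ *)

(* Defs.v *)
From mathcomp Require Import all_boot all_order all_algebra.
From mathcomp Require Import all_classical all_reals all_analysis.
Set Implicit Arguments.
Unset Strict Implicit.
Unset Printing Implicit Defensive.
Import Order.TTheory GRing.Theory Num.Theory.
Import numFieldNormedType.Exports.
Local Open Scope classical_set_scope.
Local Open Scope ring_scope.

(* Functions on [0, oo) are total functions R -> R of which only the values on
   [0, oo) are used; continuity at 0 is therefore one-sided. *)
Definition CB (R : realType) (g : R -> R) : Prop :=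
  {within `[0, +oo[%classic, continuous g} /\
  [bounded g t | t in `[0, +oo[%classic].

(* x^{(i,-a)} = x (x + a) ... (x + (i - 1) a); the factor of index j : 'I_i is
   the one usually numbered j + 1. *)
Definition rising (R : realType) (a x : R) (i : nat) : R :=
  \prod_(j < i) (x + j%:R * a).

(* For a = 0 the power is replaced by its limit as a -> 0+. *)
Definition RL_factor (R : realType) (b a x : R) : R :=
  if a == 0 then expR (- (b * x)) else (1 + b * a) `^ (- x / a).

Definition RL_term (R : realType) (b a phi psi : R) (g : R -> R) (x : R)
    (i : nat) : R :=
  RL_factor b a x * (a + b^-1) ^- i * (rising a x i / i`!%:R) *
  \int[@lebesgue_measure R]_(t in `[i%:R / b, i.+1%:R / b])
    g ((b * t + phi) / (b + psi)).

(* The operator for b = beta_n and a = alpha_n.  It is meaningful when the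
   series converges: [limn] of a divergent sequence is a default value. *)
Definition RL (R : realType) (b a phi psi : R) (g : R -> R) (x : R) : R :=
  b * limn (series (RL_term b a phi psi g x)).

Definition Phi2 (R : realType) (b a phi psi x : R) : R :=
  RL b a phi psi (fun t => (t - x) ^+ 2) x.

(* [sup] is the real-valued supremum, equal to 0 on unbounded sets; the sets
   below are bounded as soon as g is bounded on [0, oo). *)
Definition omega1 (R : realType) (g : R -> R) (delta : R) : R :=
  sup [set r | exists x u v : R,
    [/\ 0 <= x, 0 <= u, 0 <= v, `|u - v| <= delta &
        r = `|g (x + u) - g (x + v)|]].

Definition omega2 (R : realType) (g : R -> R) (delta : R) : R :=
  sup [set r | exists x u v : R,
    [/\ 0 <= x, 0 <= u, 0 <= v, `|u - v| <= delta &
        r = `|g (x + 2 * u) - 2 * g (x + u + v) + g (x + 2 * v)|]].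

(* Main.v *)
Require Import Defs.
From mathcomp Require Import all_boot all_order all_algebra.
From mathcomp Require Import all_classical all_reals all_analysis.
From mathcomp Require Import ring lra.
Import Order.TTheory GRing.Theory Num.Theory.
Import numFieldNormedType.Exports.
Local Open Scope classical_set_scope.
Local Open Scope ring_scope.
Set Implicit Arguments.
Unset Strict Implicit.
Unset Printing Implicit Defensive.

(* The first modulus alone suffices.  Splitting [x, y] into steps of length at
   most d gives |g y - g x| <= w (1 + (y - x)^2 / d^2) with w = omega1 g d.
   The operator is positive, linear and fixes constants, the latter being the
   binomial series sum_i x^(i,-a)/i! z^i = (1 - a z)^(-x/a) at
   z = 1 / (a + 1/b), whose sum f solves (1 - a z) f' = x f.  Applying it
   with d^2 = Phi2 > 0 therefore yields
   |RL g x - g x| <= w (1 + Phi2 / d^2) = 2 w. *)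

Lemma within_continuous_comp_sub (R : realType) (A B : set R) (g h : R -> R) :
  {within B, continuous g} -> continuous h -> (forall t, A t -> B (h t)) ->
  {within A, continuous (g \o h)}.
Proof.
move=> /subspace_continuousP cg ch hAB; apply/subspace_continuousP => t At.
apply/cvgrPdist_lt => e e0.
have /cvgrPdist_lt /(_ e e0) := cg _ (hAB _ At).
rewrite /near /= !/within /= => hn.
have : nbhs t (fun s => B (h s) -> `|g (h t) - g (h s)| < e) := ch t _ hn.
change (nbhs t (fun s => B (h s) -> `|g (h t) - g (h s)| < e) ->
  nbhs t (fun s => A s -> `|g (h t) - g (h s)| < e)).
by apply: filterS => s + As; apply; exact: hAB.
Qed.

(** * A ratio test for series with nonnegative terms *)

(** The ratio condition is stated without a quotient because the terms it is applied to vanish from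
    index 1 on when [x = 0]. *)
Definition eventually_contracting (R : realType) (u : nat -> R) : Prop :=
  exists2 q : R, q < 1 &
    exists N : nat, forall i, (N <= i)%N -> u i.+1 <= q * u i.

Lemma eventually_contracting_cvg (R : realType) (u : nat -> R) :
  (forall i, 0 <= u i) -> eventually_contracting u -> cvgn (series u).
Proof.
move=> u0 [q q1 [N hN]].
(* [q] may be negative, while the geometric majorant needs a nonnegative ratio. *)
pose r := Num.max q 0; have r0 : 0 <= r by rewrite le_max lexx orbT.
have r1 : r < 1 by rewrite gt_max q1 ltr01.
have step i : (N <= i)%N -> u i.+1 <= r * u i.
  move=> /hN /le_trans; apply; apply: ler_wpM2r => //; by rewrite le_max lexx.
have bnd k : u (N + k)%N <= u N * r ^+ k.
  elim: k => [|k IH]; first by rewrite addn0 expr0 mulr1.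
  rewrite addnS (le_trans (step _ _)) ?leq_addr// exprS mulrCA.
  exact: ler_wpM2l.
suff /cvg_ex[l cl] : cvgn (series (fun k => u (N + k)%N)).
  rewrite -(is_cvg_series_restrict N); apply/cvg_ex; exists l.
  rewrite -(cvg_shiftn N) /= (_ : (fun _ => _) = series (fun k => u (N + k)%N)) //.
  apply/funext => n; rewrite -{1}[N]add0n big_addn addnK.
  by apply: eq_bigr => i _; rewrite addnC.
apply: series_le_cvg
  (is_cvg_geometric_series _ : cvgn (series (geometric (u N) r))) => //.
- by move=> n; rewrite /= mulr_ge0// exprn_ge0.
- by rewrite ger0_norm.
Qed.

(** The new factor multiplies the ratios by [(i + 2) / (i + 1)], which tends to 1, so any [r]
    strictly between [max q 0] and 1 works from some index on. *)
Lemma eventually_contracting_natmul (R : realType) (u : nat -> R) :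
  (forall i, 0 <= u i) -> eventually_contracting u ->
  eventually_contracting (fun i => i.+1%:R * u i).
Proof.
move=> u0 [q q1 [N hN]].
pose r := (1 + Num.max q 0) / 2.
have [hr hr1 hr0]: [/\ Num.max q 0 < r, r < 1 & 0 <= Num.max q 0].
  have h1 : Num.max q 0 < 1 by rewrite gt_max q1 ltr01.
  have h0 : 0 <= Num.max q 0 by rewrite le_max lexx orbT.
  by rewrite /r; split => //; lra.
set p := Num.max q 0 in hr hr0.
(* The condition [p (i + 2) <= r (i + 1)] reads [2 p - r <= i (r - p)]; as [p < r], it follows from
   [p <= i (r - p)]. *)
exists r => //; exists (maxn N (Num.truncn (p / (r - p))).+1) => i.
rewrite geq_max => /andP[Ni].
rewrite -(ler_nat R) => hi.
have {}hi : p / (r - p) <= i%:R.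
  apply: le_trans hi; exact: ltW (real_truncnS_gt (num_real _)).
have {hi} hi : p * i.+2%:R <= r * i.+1%:R.
  move: hi; rewrite ler_pdivrMr ?subr_gt0// -[i.+2%:R]natr1 -[i.+1%:R]natr1; nra.
apply: (@le_trans _ _ (i.+2%:R * (p * u i))).
  apply: ler_wpM2l => //; apply: le_trans (hN _ Ni) _.
  by apply: ler_wpM2r => //; rewrite le_max lexx.
rewrite !mulrA [_ * p]mulrC; exact: ler_wpM2r.
Qed.

(** * The binomial series and its differential equation *)

(** The coefficient of [z ^ i] in [(1 - a z) ^ (- x / a)], or in [exp (x z)] when [a = 0]. *)
Definition rising_coef (R : realType) (a x : R) (i : nat) : R :=
  rising a x i / i`!%:R.

Lemma risingS (R : realType) (a x : R) (i : nat) :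
  rising a x i.+1 = rising a x i * (x + i%:R * a).
Proof. by rewrite /rising big_ord_recr. Qed.

Lemma rising_coef0 (R : realType) (a x : R) : rising_coef a x 0 = 1.
Proof. by rewrite /rising_coef /rising big_ord0 fact0 divr1. Qed.

Lemma rising_coefS (R : realType) (a x : R) (i : nat) :
  i.+1%:R * rising_coef a x i.+1 = (x + i%:R * a) * rising_coef a x i.
Proof.
rewrite /rising_coef risingS factS natrM.
have : (i.+1%:R : R) != 0 by rewrite pnatr_eq0.
have : (i`!%:R : R) != 0 by rewrite pnatr_eq0 -lt0n fact_gt0.
move: i.+1%:R i`!%:R => p q q0 p0.
by field; rewrite p0 q0.
Qed.

Lemma rising_coef_ge0 (R : realType) (a x : R) (i : nat) :
  0 <= a -> 0 <= x -> 0 <= rising_coef a x i.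
Proof.
move=> a0 x0; rewrite /rising_coef divr_ge0 ?ler0n// /rising prodr_ge0// => j _.
by rewrite addr_ge0// mulr_ge0.
Qed.

(** By [rising_coefS], successive terms have ratio [z (x + i a) / (i + 1)], which tends to
    [a z < 1]. *)
Lemma eventually_contracting_rising (R : realType) (a x z : R) :
  0 <= a -> 0 <= x -> 0 <= z -> a * z < 1 ->
  eventually_contracting (fun i => rising_coef a x i * z ^+ i).
Proof.
move=> a0 x0 z0 az1.
have [q q1 azq] : exists2 q, q < 1 & a * z < q.
  by exists ((1 + a * z) / 2); lra.
exists q => //; exists (Num.truncn (z * x / (q - a * z))).+1 => i.
rewrite -(ler_nat R) => hi.
have {}hi : z * x / (q - a * z) <= i%:R.
  exact: le_trans (ltW (real_truncnS_gt (num_real _))) hi.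
have {}hi : z * (x + i%:R * a) <= q * i.+1%:R.
  have az0 : 0 <= a * z by exact: mulr_ge0.
  by move: hi; rewrite ler_pdivrMr ?subr_gt0// -[i.+1%:R]natr1; nra.
have i1 : 0 < (i.+1%:R : R) by rewrite ltr0n.
rewrite -(ler_pM2l i1).
have -> : i.+1%:R * (rising_coef a x i.+1 * z ^+ i.+1) =
  (z * (x + i%:R * a)) * (rising_coef a x i * z ^+ i).
  rewrite mulrA rising_coefS exprS; ring.
have -> : i.+1%:R * (q * (rising_coef a x i * z ^+ i)) =
  (q * i.+1%:R) * (rising_coef a x i * z ^+ i) by ring.
by apply: ler_wpM2r => //; rewrite mulr_ge0 ?rising_coef_ge0 ?exprn_ge0.
Qed.

(** The quadratic factor makes this a common majorant for the series, its first two formal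
    derivatives, and the second moment of the operator. *)
Lemma is_cvg_rising_sqr (R : realType) (a x z : R) :
  0 <= a -> 0 <= x -> 0 <= z -> a * z < 1 ->
  cvgn (series (fun i => i.+1%:R ^+ 2 * (rising_coef a x i * z ^+ i))).
Proof.
move=> a0 x0 z0 az1.
have u0 i : 0 <= rising_coef a x i * z ^+ i.
  by rewrite mulr_ge0 ?rising_coef_ge0 ?exprn_ge0.
have u1 i : 0 <= i.+1%:R * (rising_coef a x i * z ^+ i) by rewrite mulr_ge0.
apply: eventually_contracting_cvg => [i|]; first by rewrite mulr_ge0 ?exprn_ge0.
under eq_fun do rewrite expr2 -mulrA.
by do 2!apply: eventually_contracting_natmul => //;
  exact: eventually_contracting_rising.
Qed.

Lemma pseries_diffs_rising (R : realType) (a x : R) :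
  pseries_diffs (rising_coef a x) =
    (fun i => (x + i%:R * a) * rising_coef a x i).
Proof. by apply/funext => i; rewrite /pseries_diffs rising_coefS. Qed.

Lemma pseries_diffs2_rising (R : realType) (a x : R) :
  pseries_diffs (pseries_diffs (rising_coef a x)) =
    (fun i => (x + i.+1%:R * a) * (x + i%:R * a) * rising_coef a x i).
Proof.
apply/funext => i; rewrite pseries_diffs_rising /pseries_diffs mulrCA.
by rewrite rising_coefS mulrA.
Qed.

Lemma is_cvg_rising_le (R : realType) (a x z C : R) (p : nat -> R) :
  0 <= a -> 0 <= x -> 0 <= z -> a * z < 1 ->
  (forall i, 0 <= p i <= C * i.+1%:R ^+ 2) ->
  cvgn (pseries (fun i => p i * rising_coef a x i) z).
Proof.
move=> a0 x0 z0 az1 hp.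
have u0 i : 0 <= rising_coef a x i * z ^+ i.
  by rewrite mulr_ge0 ?rising_coef_ge0 ?exprn_ge0.
have : cvgn (series (fun i => C * (i.+1%:R ^+ 2 * (rising_coef a x i * z ^+ i)))).
  exact: is_cvg_seriesZ (is_cvg_rising_sqr a0 x0 z0 az1).
apply: series_le_cvg => i /=.
- by rewrite -mulrA mulr_ge0//; case/andP: (hp i).
- rewrite mulrA mulr_ge0//.
  by case/andP: (hp i) => /le_trans h /h.
- rewrite -mulrA [leRHS]mulrA; apply: ler_wpM2r => //.
  by case/andP: (hp i).
Qed.

Lemma is_cvg_rising (R : realType) (a x z : R) :
  0 <= a -> 0 <= x -> 0 <= z -> a * z < 1 ->
  cvgn (pseries (rising_coef a x) z).
Proof.
move=> a0 x0 z0 az1.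
have -> : rising_coef a x = (fun i => 1 * rising_coef a x i).
  by apply/funext => i; rewrite mul1r.
apply: (@is_cvg_rising_le _ _ _ _ 1) => // i.
by rewrite ler01 mul1r exprn_ege1// ler1n.
Qed.

Lemma is_cvg_rising_diffs (R : realType) (a x z : R) :
  0 <= a -> 0 <= x -> 0 <= z -> a * z < 1 ->
  cvgn (pseries (pseries_diffs (rising_coef a x)) z).
Proof.
move=> a0 x0 z0 az1; rewrite pseries_diffs_rising.
apply: (@is_cvg_rising_le _ _ _ _ (x + a)) => // i.
rewrite addr_ge0 ?mulr_ge0//=; rewrite -natr1; set n := i%:R.
have : 0 <= n by rewrite /n.
rewrite expr2; nra.
Qed.

(** Termwise differentiation rests on convergence at [K] of the series and of its first two formal
    derivatives. *)
Lemma is_derive_rising_series (R : realType) (a x K u : R) :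
  0 <= a -> 0 <= x -> 0 <= K -> a * K < 1 -> `|u| < K ->
  is_derive u 1 (fun u => limn (pseries (rising_coef a x) u))
    (limn (pseries (pseries_diffs (rising_coef a x)) u)).
Proof.
move=> a0 x0 K0 aK1 uK.
have S1 (i : nat) : (1 : R) <= i.+1%:R by rewrite ler1n.
apply: (@pseries_snd_diffs _ _ K).
- exact: is_cvg_rising.
- exact: is_cvg_rising_diffs.
- rewrite pseries_diffs2_rising.
  (* Each of [x + (i + 1) a] and [x + i a] is at most [(x + a) (i + 1)]. *)
  apply: (@is_cvg_rising_le _ _ _ _ ((x + a) ^+ 2)) => // i.
  rewrite !mulr_ge0 ?addr_ge0 ?mulr_ge0//=.
  have := S1 i; rewrite -exprMn expr2 => h.
  apply: ler_pM; rewrite ?addr_ge0 ?mulr_ge0//.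
    by nra.
  by rewrite -natr1; have : (0 : R) <= i%:R; [by []|nra].
- by rewrite [ltRHS]ger0_norm.
Qed.

(** Summing the recurrence [(i + 1) c_(i+1) = x c_i + a i c_i] against [u ^ i] gives
    [f' = x f + a u f']. *)
Lemma rising_series_ode (R : realType) (a x K u : R) :
  0 <= a -> 0 <= x -> a * K < 1 -> `|u| < K ->
  (1 - a * u) * limn (pseries (pseries_diffs (rising_coef a x)) u) =
  x * limn (pseries (rising_coef a x) u).
Proof.
move=> a0 x0 aK1 uK; set c := rising_coef a x.
have K0 : 0 <= K by apply: le_trans (ltW uK).
have uK' : `|u| < `|K| by rewrite [ltRHS]ger0_norm.
have cc : cvgn (pseries c u).
  by apply: is_cvg_pseries_inside uK'; exact: is_cvg_rising.
have cd : cvgn (pseries (pseries_diffs c) u).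
  by apply: is_cvg_pseries_inside uK'; exact: is_cvg_rising_diffs.
(* The series of [i c_i u ^ (i - 1)] is the derived series with its index shifted; this gives it the
   same limit. *)
have ce := pseries_diffs_equiv cd.
have key : pseries (pseries_diffs c) u =
    (fun n => x * pseries c u n +
              a * u * series (fun i => i%:R * c i * u ^+ i.-1) n).
  apply/funext => n; rewrite /pseries /series /= !mulr_sumr -big_split.
  apply: eq_bigr => i _; rewrite /c pseries_diffs_rising.
  case: i => [|i] /=; first by rewrite !mul0r mulr0 !addr0 mulrA.
  by rewrite exprS; ring.
have cl : pseries (pseries_diffs c) u @ \oo -->
    x * limn (pseries c u) + a * u * limn (pseries (pseries_diffs c) u).
  by rewrite {1}key; apply: cvgD; apply: cvgM => //; exact: cvg_cst.
by rewrite mulrBl mul1r {1}(cvg_lim (@Rhausdorff R) cl) addrK.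
Qed.

Lemma scaleE (R : realType) (x y : R) : x *: (y : R^o) = x * y.
Proof. by []. Qed.

(** By the differential equation, [f exp (- L)] has zero derivative on [[0, z]], so it keeps its
    value 1 at 0. Leaving the antiderivative [L] abstract treats [a = 0] and [a > 0] together. *)
Lemma rising_series_expR (R : realType) (a x z : R) (L : R -> R) :
  0 <= a -> 0 <= x -> 0 <= z -> a * z < 1 -> L 0 = 0 ->
  (forall u, 0 <= u <= z -> is_derive u 1 L (x / (1 - a * u))) ->
  limn (pseries (rising_coef a x) z) = expR (L z).
Proof.
move=> a0 x0 z0 az1 L0 dL; pose f u := limn (pseries (rising_coef a x) u).
have [K zK aK1] : exists2 K, z < K & a * K < 1.
  (* A point beyond [z] but still inside the disc of radius [1 / a]; the denominator uses [a + 1]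
     because [a] may be 0. *)
  exists (z + (1 - a * z) / (2 * (a + 1))).
    by rewrite ltrDl divr_gt0//; lra.
  rewrite mulrDr mulrA -ltrBrDl ltr_pdivrMr; last by lra.
  by nra.
pose h : R -> R := fun u => f u * expR (- L u).
have dh u : u \in `[0, z] -> is_derive u 1 h 0.
  rewrite in_itv /= => /andP[u0 uz].
  have uK : `|u| < K by rewrite ger0_norm//; exact: le_lt_trans zK.
  have K0 : 0 <= K by exact: le_trans (ltW zK).
  have au : 1 - a * u != 0.
    by rewrite subr_eq0 eq_sym lt_eqF// (le_lt_trans _ az1)// ler_wpM2l.
  have df := is_derive_rising_series a0 x0 K0 aK1 uK.
  have dLu : is_derive u 1 L (x / (1 - a * u)) by apply: dL; rewrite u0.
  have de := is_derive1_comp (is_derive_expR _) (is_deriveN dLu).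
  apply: is_derive_eq (is_deriveM df de) _.
  have := rising_series_ode a0 x0 aK1 uK.
  set D := limn (pseries (pseries_diffs _) u).
  set F := limn (pseries (rising_coef a x) u) => ode.
  set E := expR ((- L) u).
  change (F * (E * - (x / (1 - a * u))) + E * D = 0).
  have -> : D = x * F / (1 - a * u) by rewrite -ode mulrC mulrA mulVf ?mul1r.
  ring.
have mvt := @MVT_segment R h (fun=> 0) 0 z z0.
have hoo u : u \in `]0, z[%R -> is_derive u 1 h 0.
  by move=> /subset_itv_oo_cc; exact: dh.
have hc : {within `[0, z], continuous h}.
  by apply: derivable_within_continuous => u /dh [].
have [c _] := mvt hoo hc.
rewrite mul0r => /eqP; rewrite subr_eq0 => /eqP.
rewrite /h.
have -> : f 0 = 1.
  rewrite /f; apply: (cvg_lim (@Rhausdorff R)).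
  (* At 0 every nonempty partial sum equals the constant term, since [0 ^ 0 = 1]; the shift skips
     the empty sum. *)
  rewrite -cvg_shiftS; apply: cvg_near_cst; apply: nearW => n /=.
  rewrite /pseries /series /= big_nat_recl// expr0 mulr1 rising_coef0.
  by rewrite big1 ?addr0// => i _; rewrite expr0n mulr0.
rewrite L0 oppr0 expR0 mulr1 expRN => fL.
by rewrite -[LHS](divfK (lt0r_neq0 (expR_gt0 (L z)))) fL mul1r.
Qed.

(** * Normalisation of the operator *)

Lemma RL_radius (R : realType) (a b : R) : 0 <= a -> 0 < b ->
  0 <= (a + b^-1)^-1 /\ a * (a + b^-1)^-1 < 1.
Proof.
move=> a0 b0; have bV : 0 < b^-1 by rewrite invr_gt0.
have ab0 : 0 < a + b^-1 by rewrite ltr_wpDl.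
by rewrite invr_ge0 ltW// ltr_pdivrMr// mul1r ltrDl.
Qed.

(** Here [L u] is [x u] if [a = 0] and [- (x / a) ln (1 - a u)] otherwise; at [z] its exponential is
    the inverse of [RL_factor]. *)
Lemma RL_factor_sum (R : realType) (a b x : R) :
  0 <= a -> 0 < b -> 0 <= x ->
  RL_factor b a x * limn (pseries (rising_coef a x) (a + b^-1)^-1) = 1.
Proof.
move=> a0 b0 x0; set z := (a + b^-1)^-1.
have ab0 : 0 < a + b^-1 by rewrite ltr_wpDl// invr_gt0.
have [z0 az1] := RL_radius a0 b0; rewrite -/z in z0 az1.
rewrite /RL_factor; have [a00|an0] := eqVneq a 0.
  have -> : limn (pseries (rising_coef a x) z) = expR (x * z).
    apply: (@rising_series_expR _ _ _ _ (fun u => x * u)) => //.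
      by rewrite mulr0.
    move=> u _; rewrite a00 mul0r subr0 divr1.
    apply: (is_derive_eq (is_deriveZ x (is_derive_id u 1))).
    by rewrite scaleE mulr1.
  by rewrite /z a00 add0r invrK -expRD mulrC addNr expR0.
pose L (u : R) := - (x / a) * ln (1 - a * u).
have -> : limn (pseries (rising_coef a x) z) = expR (L z).
  have L0 : L 0 = 0 by rewrite /L mulr0 subr0 ln1 mulr0.
  apply: (rising_series_expR a0 x0 z0 az1 L0) => u /andP[u0 uz].
  have au : 0 < 1 - a * u by rewrite subr_gt0 (le_lt_trans _ az1)// ler_wpM2l.
  have d1 : is_derive u 1 (fun u : R => 1 - a * u) (0 - a *: 1).
    have dc : is_derive u 1 (cst 1 : R -> R) 0 by exact: is_derive_cst.
    exact: (is_deriveB dc (is_deriveZ a (is_derive_id u 1))).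
  have d2 := @is_derive1_comp R (@ln R) (fun u : R => 1 - a * u) _ _ _
    (is_derive1_ln au) d1.
  apply: is_derive_eq (is_deriveZ (- (x / a)) d2) _.
  by rewrite !scaleE; field; rewrite an0 lt0r_neq0.
have ab1 : 0 < 1 + b * a by rewrite ltr_pwDl// mulr_ge0// ltW.
(* This identity turns [L z] into [(x / a) ln (1 + b a)], the opposite of the exponent in the
   power. *)
rewrite /L; have -> : 1 - a * z = (1 + b * a)^-1.
  by rewrite /z; field; rewrite !lt0r_neq0//= mulrC addrC.
rewrite lnV ?posrE// /powR gt_eqF// -expRD.
by rewrite [X in expR X](_ : _ = 0) ?expR0//; ring.
Qed.

(** * Estimates for the moduli *)

(** The elements are absolute values, and if the set has no supremum, [sup] takes its default value
    0. *)
Lemma omega1_ge0 (R : realType) (g : R -> R) (delta : R) : 0 <= omega1 g delta.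
Proof.
rewrite /omega1; set S := [set _ | _].
have [|/sup_out ->//] := pselect (has_sup S).
case=> -[r Sr] ubS; apply: le_trans (ub_le_sup ubS Sr).
by case: Sr => x [u [v [_ _ _ _ ->]]].
Qed.

Lemma omega2_ge0 (R : realType) (g : R -> R) (delta : R) : 0 <= omega2 g delta.
Proof.
rewrite /omega2; set S := [set _ | _].
have [|/sup_out ->//] := pselect (has_sup S).
case=> -[r Sr] ubS; apply: le_trans (ub_le_sup ubS Sr).
by case: Sr => x [u [v [_ _ _ _ ->]]].
Qed.

Lemma le_omega1 (R : realType) (g : R -> R) (delta x y : R) :
  [bounded g t | t in `[0, +oo[%classic] -> 0 <= x -> 0 <= y ->
  `|x - y| <= delta -> `|g x - g y| <= omega1 g delta.
Proof.
move=> [M [_ hM]] x0 y0 xy; apply: ub_le_sup; last first.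
  by exists 0, x, y; rewrite !add0r.
(* Boundedness provides a bound by every number above [M], hence by [M + 1]. *)
have hg t : 0 <= t -> `|g t| <= M + 1.
  by move=> t0; apply: (hM (M + 1)); rewrite ?ltrDl//= in_itv/= t0.
exists (M + 1 + (M + 1)) => _ [s [u [v [s0 u0 v0 _ ->]]]].
by apply: le_trans (ler_normB _ _) _; apply: lerD; apply: hg; apply: addr_ge0.
Qed.

(** Induction on the number of steps: if [y - x] exceeds [delta], the last step, from [y - delta] to
    [y], is split off and [y - delta] still lies to the right of [x]. *)
Lemma le_omega1_natmul (R : realType) (g : R -> R) (delta : R) (m : nat) (x y : R) :
  [bounded g t | t in `[0, +oo[%classic] -> 0 <= delta -> 0 <= x -> x <= y ->
  y - x <= m%:R * delta -> `|g y - g x| <= m%:R * omega1 g delta.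
Proof.
move=> bg d0 x0; elim: m y => [|m IH] y xy.
  rewrite !mul0r => yx; have -> : y = x by lra.
  by rewrite subrr normr0.
rewrite -natr1 !mulrDl !mul1r => hy.
have [yd|yd] := leP (y - x) delta.
  apply: le_trans (le_omega1 (delta := delta) bg (le_trans x0 xy) x0 _) _.
    by rewrite ger0_norm// subr_ge0.
  by rewrite lerDr mulr_ge0// omega1_ge0.
have -> : g y - g x = (g (y - delta) - g x) + (g y - g (y - delta)) by ring.
apply: le_trans (ler_normD _ _) _; apply: lerD.
  by apply: IH; lra.
by apply: le_omega1 => //; rewrite ?subKr ?ger0_norm//; lra.
Qed.

(** With [q = |y - x| / delta], one step suffices if [q <= 1]; otherwise [floor q + 1] steps do, and
    this is at most [1 + q ^ 2] because [q <= q ^ 2]. *)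
Lemma le_omega1_sqr (R : realType) (g : R -> R) (delta x y : R) :
  [bounded g t | t in `[0, +oo[%classic] -> 0 < delta -> 0 <= x -> 0 <= y ->
  `|g y - g x| <= omega1 g delta + omega1 g delta / delta ^+ 2 * (y - x) ^+ 2.
Proof.
move=> bg d0; wlog xy : x y / x <= y => [hw x0 y0|x0 y0].
  have [xy|/ltW yx] := leP x y; first exact: hw.
  by rewrite distrC -[y - x]opprB sqrrN; exact: hw.
have w0 := omega1_ge0 g delta; set w := omega1 g delta in w0 *.
pose q := (y - x) / delta.
have q0 : 0 <= q by rewrite divr_ge0 ?subr_ge0// ltW.
have -> : w + w / delta ^+ 2 * (y - x) ^+ 2 = (1 + q ^+ 2) * w.
  by rewrite /q; field; rewrite gt_eqF.
have yxq : y - x = q * delta by rewrite /q divfK// gt_eqF.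
have [q1|q1] := leP q 1.
  apply: le_trans (le_omega1 bg y0 x0 (_ : _ <= delta)) _.
    by rewrite ger0_norm ?subr_ge0// yxq ler_piMl// ltW.
  by rewrite ler_peMl// lerDl sqr_ge0.
have /andP[qt tq] := truncn_itv q0.
apply: le_trans (le_omega1_natmul (m := (Num.truncn q).+1) bg (ltW d0) x0 xy _) _.
  by rewrite yxq; apply: ler_wpM2r; exact: ltW.
apply: ler_wpM2r => //; rewrite -natr1 addrC lerD2l (le_trans qt)//. 
by rewrite expr2 ler_peMr// ltW.
Qed.

(** * Integrals over the cells [[i / b, (i + 1) / b]] *)

(** The affine map sends [[c, d]] into [[0, oo)], so continuity on the half-line gives continuity on
    a compact interval. *)
Lemma integrable_itv_comp (R : realType) (f : R -> R) (b phi psi c d : R) :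
  {within `[0, +oo[%classic, continuous f} ->
  0 < b -> 0 <= phi -> phi <= psi -> 0 <= c ->
  (@lebesgue_measure R).-integrable `[c, d]
    (EFin \o (fun t => f ((b * t + phi) / (b + psi)))).
Proof.
move=> cf b0 phi0 phipsi c0.
apply: continuous_compact_integrable; first exact: segment_compact.
apply: (within_continuous_comp_sub cf) => [t|t /=].
  apply: cvgM; last exact: cvg_cst.
  apply: cvgD; last exact: cvg_cst.
  by apply: cvgM; [exact: cvg_cst|exact: cvg_id].
rewrite !in_itv /= andbT => /andP[ct _].
have t0 := le_trans c0 ct; have psi0 := le_trans phi0 phipsi.
by rewrite divr_ge0 ?addr_ge0 ?mulr_ge0 ?(ltW b0).
Qed.

Lemma Rintegral_itv_cst (R : realType) (b k : R) (i : nat) : 0 < b ->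
  \int[@lebesgue_measure R]_(t in `[i%:R / b, i.+1%:R / b]) k = k / b.
Proof.
move=> b0; rewrite Rintegral_cst//= lebesgue_measure_itv /= lte_fin.
rewrite ltr_pM2r ?invr_gt0// ltr_nat ltnSn /= -mulrBl -natr1 addrAC subrr.
by rewrite add0r mul1r.
Qed.

(** Strictness is read off an explicit antiderivative: a positive multiple of the cube of an
    increasing affine function. *)
Lemma Rintegral_sqr_gt0 (R : realType) (b phi psi x : R) :
  0 < b -> 0 <= phi -> phi <= psi ->
  0 < \int[@lebesgue_measure R]_(t in `[0, 1 / b])
        ((b * t + phi) / (b + psi) - x) ^+ 2.
Proof.
move=> b0 phi0 phipsi.
have bpsi : 0 < b + psi by rewrite ltr_wpDr// (le_trans phi0).
pose A := b / (b + psi); pose B := phi / (b + psi) - x.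
have A0 : 0 < A by rewrite divr_gt0.
pose F : R -> R := fun t => (A * t + B) ^+ 3 / (3 * A).
have dF (t : R) : is_derive t 1 F (((b * t + phi) / (b + psi) - x) ^+ 2).
  have d1 : is_derive t 1 (fun u : R => A * u + B) (A *: 1 + 0).
    have dc : is_derive t 1 (cst B : R -> R) 0 by exact: is_derive_cst.
    exact: (is_deriveD (is_deriveZ A (is_derive_id t 1)) dc).
  have d3 := @is_deriveX R R^o (fun u : R => A * u + B) 3 t 1 _ d1.
  have -> : F = (fun u => (3 * A)^-1 *: ((fun u : R => A * u + B) ^+ 3) u).
    by apply/funext => u; rewrite /F mulrC.
  apply: is_derive_eq (is_deriveZ _ d3) _.
  rewrite !scaleE /A /B; field.
  by rewrite !gt_eqF.
have b1 : (0 : R) < 1 / b by rewrite divr_gt0.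
rewrite /Rintegral (@continuous_FTC2 _ _ F)//=.
- have A3 : 0 < (3 * A)^-1 by rewrite invr_gt0; apply: mulr_gt0.
  rewrite subr_gt0 /F (ltr_pM2r A3).
  rewrite mulr0 add0r -subr_gt0.
  have Ab : 0 < A * (1 / b) by rewrite mulr_gt0.
  move: (A * (1 / b)) Ab => s s0.
  (* Completing the square isolates [(s / 2) ^ 2 > 0], whatever the sign of [B]. *)
  have -> : (s + B) ^+ 3 - B ^+ 3 =
      s * ((s / 2) ^+ 2 + 3 * (B + s / 2) ^+ 2) by field.
  apply: mulr_gt0 => //; apply: ltr_wpDr; first by rewrite mulr_ge0 ?sqr_ge0.
  by rewrite exprn_gt0 ?divr_gt0.
- apply: continuous_subspaceT => t.
  under eq_fun do rewrite expr2.
  have cc : {for t, continuous (fun t : R => (b * t + phi) / (b + psi) - x)}.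
    apply: cvgB; last exact: cvg_cst.
    apply: cvgM; last exact: cvg_cst.
    apply: cvgD; last exact: cvg_cst.
    by apply: cvgM; [exact: cvg_cst|exact: cvg_id].
  exact: cvgM.
- have cF t : {for t, continuous F}.
    by apply/differentiable_continuous; rewrite -derivable1_diffP; case: (dF t).
  split; first by move=> t _; case: (dF t).
  - by apply: cvg_at_right_filter; exact: cF.
  - by apply: cvg_at_left_filter; exact: cF.
- by move=> t _; rewrite derive1E; case: (dF t).
Qed.

(** * Passage to the limit and the weights of the operator *)

(** The differences [t i - c * w i] are dominated by a convergent series. Convergence of [series t]
    is thus a consequence, and its [limn] is a genuine limit. *)
Lemma le_norm_lim_series (R : realType) (t w v : R^nat) (c p q W V : R) :
  (forall i, `|t i - c * w i| <= p * w i + q * v i) ->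
  series w @ \oo --> W -> series v @ \oo --> V ->
  `|limn (series t) - c * W| <= p * W + q * V.
Proof.
move=> h cw cv; pose e i := t i - c * w i; pose m i := p * w i + q * v i.
have em : series m @ \oo --> p * W + q * V.
  rewrite (_ : series m = (fun n => p * series w n + q * series v n)).
    by apply: cvgD; apply: cvgM => //; exact: cvg_cst.
  by apply/funext => n; rewrite /series /= !mulr_sumr -big_split.
have m0 i : 0 <= m i by apply: le_trans (h i).
have ce : cvgn [normed series e].
  by apply: series_le_cvg (cvgP _ em) => // i; exact: normr_ge0.
have ct : series t @ \oo --> limn (series e) + c * W.
  rewrite (_ : series t = (fun n => series e n + c * series w n)).
    apply: cvgD; first exact: normed_cvg.
    by apply: cvgM => //; exact: cvg_cst.
  apply/funext => n; rewrite /series /= mulr_sumr -big_split.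
  by apply: eq_bigr => i _ /=; rewrite subrK.
rewrite (cvg_lim (@Rhausdorff R) ct) addrK.
apply: le_trans (lim_series_norm ce) _.
rewrite -(cvg_lim (@Rhausdorff R) em).
by apply: lim_series_le (cvgP _ em) _ => // i; exact: h.
Qed.

(** For [a > 0] and [x > 0] these are negative binomial probabilities with parameter [x / a]; for
    [a = 0] they are Poisson with mean [b x]. *)
Definition RL_weight (R : realType) (b a x : R) (i : nat) : R :=
  RL_factor b a x * (rising_coef a x i * (a + b^-1)^-1 ^+ i).

Lemma RL_termE (R : realType) (b a phi psi : R) (g : R -> R) (x : R) (i : nat) :
  RL_term b a phi psi g x i = RL_weight b a x i *
    \int[@lebesgue_measure R]_(t in `[i%:R / b, i.+1%:R / b])
      g ((b * t + phi) / (b + psi)).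
Proof.
rewrite /RL_term /RL_weight -/(rising_coef a x i) -exprVn; congr (_ * _).
by rewrite -mulrA [_ ^+ _ * _]mulrC.
Qed.

Lemma RL_factor_gt0 (R : realType) (b a x : R) :
  0 < b -> 0 <= a -> 0 < RL_factor b a x.
Proof.
move=> b0 a0; rewrite /RL_factor; case: ifP => _; first exact: expR_gt0.
by rewrite powR_gt0// ltr_pwDl// mulr_ge0// ltW.
Qed.

Lemma RL_weight_ge0 (R : realType) (b a x : R) (i : nat) :
  0 < b -> 0 <= a -> 0 <= x -> 0 <= RL_weight b a x i.
Proof.
move=> b0 a0 x0; apply: mulr_ge0; first by rewrite ltW// RL_factor_gt0.
apply: mulr_ge0; first exact: rising_coef_ge0.
by rewrite exprn_ge0// invr_ge0 addr_ge0// invr_ge0 ltW.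
Qed.

Lemma cvg_RL_weight (R : realType) (b a x : R) :
  0 < b -> 0 <= a -> 0 <= x -> series (RL_weight b a x) @ \oo --> (1 : R).
Proof.
move=> b0 a0 x0; have [z0 az1] := RL_radius a0 b0.
rewrite -(RL_factor_sum a0 b0 x0).
set z := (a + b^-1)^-1 in z0 az1 *.
have cc := is_cvg_rising a0 x0 z0 az1.
rewrite (_ : series _ =
    (fun n => RL_factor b a x * pseries (rising_coef a x) z n)).
  by apply: cvgM => //; exact: cvg_cst.
by apply/funext => n; rewrite /pseries /series /= mulr_sumr.
Qed.

Lemma continuous_sqr_sub (R : realType) (x : R) :
  continuous (fun s : R => (s - x) ^+ 2).
Proof.
move=> s; under eq_fun do rewrite expr2.
have cc : {for s, continuous (fun s : R => s - x)}.
  by apply: cvgB; [exact: cvg_id|exact: cvg_cst].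
exact: cvgM.
Qed.

(** On the cell, [y] lies between 0 and [i + 1 + phi] because [b + psi >= 1]; hence
    [|y - x| <= (1 + phi + x) (i + 1)], and the cell has length [1 / b]. *)
Lemma Rintegral_sqr_le (R : realType) (b phi psi x : R) (i : nat) :
  1 <= b -> 0 <= phi -> phi <= psi -> 0 <= x ->
  0 <= \int[@lebesgue_measure R]_(t in `[i%:R / b, i.+1%:R / b])
        ((b * t + phi) / (b + psi) - x) ^+ 2
    <= (1 + phi + x) ^+ 2 * i.+1%:R ^+ 2 / b.
Proof.
move=> b1 phi0 phipsi x0; have b0 : 0 < b by exact: lt_le_trans b1.
apply/andP; split; first by apply: Rintegral_ge0 => t _; exact: sqr_ge0.
rewrite -(@Rintegral_itv_cst _ b _ i b0).
have i0 : 0 <= i%:R / b by rewrite divr_ge0// ltW.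
apply: le_Rintegral => //.
- apply: (@integrable_itv_comp _ (fun s => (s - x) ^+ 2)) => //.
  by apply: continuous_subspaceT; exact: continuous_sqr_sub.
- apply: (@integrable_itv_comp _ (fun=> _)) => //.
  by apply: continuous_subspaceT => s; exact: cvg_cst.
move=> t /=; rewrite in_itv /= ler_pdivrMr// ler_pdivlMr// => /andP[t1 t2].
have psi0 := le_trans phi0 phipsi.
have bpsi : 0 < b + psi by rewrite ltr_wpDr.
have bt0 : 0 <= b * t by rewrite mulrC; exact: le_trans t1.
set y := (b * t + phi) / (b + psi).
have y0 : 0 <= y by rewrite divr_ge0 ?addr_ge0// ltW.
have yle : y <= i.+1%:R + phi.
  rewrite ler_pdivrMr//; have : t * b <= i.+1%:R by []; move: t2.
  have : (1 : R) <= i.+1%:R by rewrite ler1n.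
  move: i.+1%:R => n n1 tn _.
  have : (n + phi) * 1 <= (n + phi) * (b + psi) by apply: ler_wpM2l; lra.
  lra.
have n1 : (1 : R) <= i.+1%:R by rewrite ler1n.
move: i.+1%:R n1 yle => n n1 yle.
rewrite -exprMn -ler_sqrt ?sqr_ge0// !sqrtr_sqr.
rewrite [leRHS]ger0_norm; last by rewrite mulr_ge0; lra.
by rewrite ler_norml; apply/andP; split; nra.
Qed.

(** * The second moment *)

Lemma is_cvg_Phi2 (R : realType) (b a phi psi x : R) :
  1 <= b -> 0 <= a -> 0 <= phi -> phi <= psi -> 0 <= x ->
  cvgn (series (RL_term b a phi psi (fun t => (t - x) ^+ 2) x)).
Proof.
move=> b1 a0 phi0 phipsi x0; have b0 : 0 < b by exact: lt_le_trans b1.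
have [z0 az1] := RL_radius a0 b0.
have := is_cvg_rising_sqr a0 x0 z0 az1.
move=> /(is_cvg_seriesZ (k := RL_factor b a x * ((1 + phi + x) ^+ 2 / b))).
have w0 i := RL_weight_ge0 i b0 a0 x0.
have f0 := ltW (RL_factor_gt0 x b0 a0).
apply: series_le_cvg => i.
- rewrite RL_termE mulr_ge0//.
  by case/andP: (Rintegral_sqr_le i b1 phi0 phipsi x0).
- change (0 <= RL_factor b a x * ((1 + phi + x) ^+ 2 / b) *
    (i.+1%:R ^+ 2 * (rising_coef a x i * (a + b^-1)^-1 ^+ i))).
  apply: mulr_ge0; apply: mulr_ge0 => //; first by rewrite divr_ge0 ?sqr_ge0 ?ltW.
  by apply: mulr_ge0; [exact: rising_coef_ge0|exact: exprn_ge0].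
- change (RL_term b a phi psi (fun t => (t - x) ^+ 2) x i <=
    RL_factor b a x * ((1 + phi + x) ^+ 2 / b) *
    (i.+1%:R ^+ 2 * (rising_coef a x i * (a + b^-1)^-1 ^+ i))).
  rewrite RL_termE; case/andP: (Rintegral_sqr_le i b1 phi0 phipsi x0) => _ h.
  apply: le_trans (ler_wpM2l (w0 i) h) _.
  rewrite /RL_weight le_eqVlt; apply/orP; left; apply/eqP; ring.
Qed.

(** All terms are nonnegative and the one of index 0 is positive, even at [x = 0]. This permits
    division by [Phi2] in the choice of [delta]. *)
Lemma Phi2_gt0 (R : realType) (b a phi psi x : R) :
  1 <= b -> 0 <= a -> 0 <= phi -> phi <= psi -> 0 <= x ->
  0 < Phi2 b a phi psi x.
Proof.
move=> b1 a0 phi0 phipsi x0; have b0 : 0 < b by exact: lt_le_trans b1.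
have cv := is_cvg_Phi2 b1 a0 phi0 phipsi x0.
set v := RL_term b a phi psi (fun t => (t - x) ^+ 2) x in cv *.
have v0 i : 0 <= v i.
  rewrite /v RL_termE mulr_ge0 ?RL_weight_ge0//.
  by case/andP: (Rintegral_sqr_le i b1 phi0 phipsi x0).
apply: mulr_gt0 => //.
have ndv : nondecreasing_seq (series v) by apply: nondecreasing_series.
(* The partial sum at 1 is the single term of index 0, whose weight is [RL_factor]. *)
apply: lt_le_trans (nondecreasing_cvgn_le ndv cv 1%N).
rewrite /series /= big_nat1 /v RL_termE mul0r; apply: mulr_gt0.
  by rewrite /RL_weight rising_coef0 expr0 !mulr1 RL_factor_gt0.
exact: Rintegral_sqr_gt0.
Qed.

(** * The estimate by the first modulus *)

Lemma RL_omega1 (R : realType) (b a phi psi : R) (g : R -> R) (x : R) :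
  1 <= b -> 0 <= a -> 0 <= phi -> phi <= psi -> CB g -> 0 <= x ->
  `|RL b a phi psi g x - g x| <=
    2 * omega1 g (Num.sqrt (Phi2 b a phi psi x)).
Proof.
move=> b1 a0 phi0 phipsi [cg bg] x0; have b0 : 0 < b by exact: lt_le_trans b1.
have P0 := Phi2_gt0 b1 a0 phi0 phipsi x0.
set P := Phi2 b a phi psi x in P0 *; set d := Num.sqrt P.
have d0 : 0 < d by rewrite sqrtr_gt0.
have dP : d ^+ 2 = P by rewrite sqr_sqrtr// ltW.
set w := omega1 g d; have w0 : 0 <= w := omega1_ge0 g d.
have psi0 := le_trans phi0 phipsi.
have bpsi : 0 < b + psi by rewrite ltr_wpDr.
have cv := is_cvg_Phi2 b1 a0 phi0 phipsi x0.
set v := RL_term b a phi psi (fun t => (t - x) ^+ 2) x in cv *.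
have cs : {within `[0, +oo[%classic, continuous (fun s : R => (s - x) ^+ 2)}.
  by apply: continuous_subspaceT; exact: continuous_sqr_sub.
have cc k : {within `[0, +oo[%classic, continuous (fun _ : R => k : R)}.
  by apply: continuous_subspaceT => s; exact: cvg_cst.
(* This is [le_omega1_sqr] integrated over the cell and multiplied by the weight; the factors
   [1 / b] are the cell length. *)
have key i : `|RL_term b a phi psi g x i - g x / b * RL_weight b a x i| <=
    w / b * RL_weight b a x i + w / P * v i.
  have i0 : 0 <= i%:R / b by rewrite divr_ge0// ltW.
  pose h (t : R) := (b * t + phi) / (b + psi).
  have int (f : R -> R) : {within `[0, +oo[%classic, continuous f} ->
      (@lebesgue_measure R).-integrable `[i%:R / b, i.+1%:R / b]
        (EFin \o (fun t => f (h t))).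
    by move=> cf; exact: (integrable_itv_comp _ cf).
  rewrite /v !RL_termE -/h.
  rewrite [g x / b * _]mulrC [w / b * _]mulrC [w / P * _]mulrCA -mulrBr -mulrDr.
  rewrite normrM ger0_norm ?RL_weight_ge0//.
  apply: ler_wpM2l; first exact: RL_weight_ge0.
  (* Writing the constants as integrals over the cell reduces the claim to a pointwise comparison of
     integrands. *)
  rewrite -(Rintegral_itv_cst (g x) i b0) -(Rintegral_itv_cst w i b0).
  have intg := int _ cg.
  have ints := int _ cs.
  have intc k := int _ (cc k).
  rewrite -RintegralB// -RintegralZl//.
  have intgc : (@lebesgue_measure R).-integrable `[i%:R / b, i.+1%:R / b]
      (EFin \o (fun t => g (h t) - g x)).
    exact: (integrableB _ intg (intc (g x))).
  have intZ : (@lebesgue_measure R).-integrable `[i%:R / b, i.+1%:R / b]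
      (EFin \o (fun t => w / P * (h t - x) ^+ 2)).
    exact: (integrableZl _ (w / P) ints).
  rewrite -RintegralD//.
  apply: le_trans (le_normr_Rintegral _ intgc) _ => //.
  apply: le_Rintegral => //.
  - exact: (integrable_norm intgc).
  - exact: (integrableD _ (intc w) intZ).
  move=> t /=; rewrite in_itv /= => /andP[it _].
  rewrite /w -dP; apply: le_omega1_sqr => //.
  by rewrite divr_ge0 ?(ltW bpsi)// addr_ge0// mulr_ge0 ?(ltW b0)// (le_trans i0).
have := le_norm_lim_series key (cvg_RL_weight b0 a0 x0) cv.
rewrite !mulr1 => H.
have -> : RL b a phi psi g x - g x =
    b * (limn (series (RL_term b a phi psi g x)) - g x / b).
  by rewrite mulrBr mulrCA divff ?mulr1// gt_eqF.
rewrite normrM (gtr0_norm b0).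
apply: le_trans (ler_wpM2l (ltW b0) H) _.
rewrite mulrDr mulrCA divff ?gt_eqF// mulr1.
(* By definition [b * limn (series v)] is [P]; with [d ^ 2 = P] the quadratic part therefore
   contributes exactly one more [w]. *)
have -> : b * (w / P * limn (series v)) = w / P * P.
  by rewrite /P /Phi2 /RL -/v mulrCA.
by rewrite divfK ?gt_eqF// mulrDl mul1r.
Qed.

Theorem theorem2p1 (R : realType) (beta alpha : nat -> R) (phi psi : R)
  (hbeta_incr : forall m n : nat, (1 <= m)%N -> (m < n)%N -> beta m < beta n)
  (hbeta1 : beta 1%N = 1)
  (hbeta_lim : beta n @[n --> \oo] --> +oo)
  (hphi : 0 <= phi) (hphipsi : phi <= psi)
  (halpha : forall n : nat, (1 <= n)%N -> 0 <= alpha n)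
  (g : R -> R) (hg : CB g) (n : nat) (hn : (1 <= n)%N) (x : R) (hx : 0 <= x) :
  `|RL (beta n) (alpha n) phi psi g x - g x| <=
    5 * (omega1 g (Num.sqrt (Phi2 (beta n) (alpha n) phi psi x)) +
         9 / 10 * omega2 g (Num.sqrt (Phi2 (beta n) (alpha n) phi psi x))).
Proof.
have b1 : 1 <= beta n.
  by move: hn; rewrite leq_eqVlt => /predU1P[<-|/(hbeta_incr 1%N n isT)/ltW];
    rewrite hbeta1.
apply: le_trans (RL_omega1 b1 (halpha n hn) hphi hphipsi hg hx) _.
(* Both moduli are nonnegative, so the right-hand side is at least [5 w >= 2 w], where
   [w = omega1 g d]. *)
set d := Num.sqrt _; have := omega1_ge0 g d; have := omega2_ge0 g d; lra.
Qed.
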